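(* Let $q$ be even and work over the field $\mathbb F_{q^2}$. Let $\ell,m$ be distinct non-tangent lines of the conic in $\mathrm{PG}(2,q^2)$ with $\hat\rho(\ell,m)=0$; then both lines are secant. For $i,j\in\{1,\dots,5\}$, let $p^4_{i,j}(1)$ be the number of non-tangent lines $n\notin\{\ell,m\}$ with $\hat\rho(\ell,n)\in\mathbf R_i$ and $\hat\rho(n,m)\in\mathbf R_j$. These numbers do not depend on the choice of $\ell,m$, and with $r=q^2-2q-1$ they are given by the symmetric matrix $(p^4_{i,j}(1))_{i,j=1}^5$: $$\begin{pmatrix}\frac{(q-2)(q-3)}2&\frac{q(q-2)}2&\frac{q(q-2)^2}2&q-2&0\\ \frac{q(q-2)}2&\frac{q(q-1)}2&\frac{q^2(q-2)}2&q&0\\ \frac{q(q-2)^2}2&\frac{q^2(q-2)}2&\frac{q(q-2)r}2&q(q-2)&0\\ q-2&q&q(q-2)&q^2-1&0\\0&0&0&0&\frac{q^2(q^2-1)}2\end{pmatrix}.$$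
   Context: Let $q$ be even and $Q=q^2$. Work in $\mathrm{PG}(2,Q)$. Conic and lines. - Points are nonzero vectors up to scalars, and $(a,b,c)^\perp$ denotes the line $aX+bY+cZ=0$. - The conic is $\mathcal O=\{(\xi,\xi^2,1)^\top:\xi\in\mathbb F_Q\}\cup\{(0,1,0)^\top\}$. - The non-tangent lines (meeting $\mathcal O$ in $0$ or $2$ points) are exactly the lines $(1,x,y)^\perp$, $x,y\in\mathbb F_Q$. - Such a line is secant if $\mathrm{Tr}(xy)=0$ and exterior if $\mathrm{Tr}(xy)=1$, where $\mathrm{Tr}$ is the absolute trace $\mathbb F_{q^2}\to\mathbb F_2$. Modified cross-ratio. - For $\ell=(1,x,y)^\perp$ and $n=(1,z,u)^\perp$: $\hat\rho(\ell,n)=x^2u^2+y^2z^2+(x+z)(y+u)$. The sets $\mathbf R_i$. - $\mathbf S_0$ is the set of elements of $\mathbb F_q$ with absolute trace $0$ (over $\mathbb F_2$), and $\mathbf S_1=\mathbb F_q\setminus\mathbf S_0$. - $\mathbf T_0$, $\mathbf T_1$ are the sets of elements of $\mathbb F_{q^2}$ of absolute trace $0$, $1$. - $\mathbf R_1=\mathbf S_0\setminus\{0\}$, $\mathbf R_2=\mathbf S_1$, $\mathbf R_3=\mathbf T_0\setminus\mathbb F_q$, $\mathbf R_4=\{0\}$, $\mathbf R_5=\mathbf T_1$. *)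

(* Defs.v *)
From mathcomp Require Import all_boot all_order all_algebra.

Set Implicit Arguments.
Unset Strict Implicit.
Unset Printing Implicit Defensive.

Import GRing.Theory.
Local Open Scope ring_scope.

Definition row3 (F : finFieldType) (a b c : F) : 'rV[F]_3 :=
  \row_(i < 3) [:: a; b; c]`_i.

Definition col3 (F : finFieldType) (a b c : F) : 'cV[F]_3 :=
  \col_(i < 3) [:: a; b; c]`_i.

(* A point of PG(2, F) is the class of a nonzero vector up to nonzero scalars;
   such a class is represented by the set of its members. *)
Definition proj_point (F : finFieldType) (v : 'cV[F]_3) : {set 'cV[F]_3} :=
  [set k *: v | k : F & k != 0].

(* For a = (a0, a1, a2), the set of points of the line a0 X + a1 Y + a2 Z = 0. *)
Definition perp (F : finFieldType) (a : 'rV[F]_3) : {set {set 'cV[F]_3}} :=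
  [set proj_point v | v : 'cV[F]_3 & (v != 0) && (a *m v == 0)].

Definition lines (F : finFieldType) : {set {set {set 'cV[F]_3}}} :=
  [set perp a | a : 'rV[F]_3 & a != 0].

Definition conic (F : finFieldType) : {set {set 'cV[F]_3}} :=
  proj_point (col3 0 1 0) |: [set proj_point (col3 xi (xi ^+ 2) 1) | xi : F].

Definition secant_lines (F : finFieldType) : {set {set {set 'cV[F]_3}}} :=
  [set L in lines F | #|L :&: conic F| == 2%N].

Definition exterior_lines (F : finFieldType) : {set {set {set 'cV[F]_3}}} :=
  [set L in lines F | #|L :&: conic F| == 0%N].

Definition nontangent_lines (F : finFieldType) : {set {set {set 'cV[F]_3}}} :=
  secant_lines F :|: exterior_lines F.

(* The pair (x, y) such that L = (1, x, y)^perp.  In characteristic 2 every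
   non-tangent line has this form, and the pair is unique (see perp1_inj), so
   the default value is irrelevant there. *)
Definition line_coord (F : finFieldType) (L : {set {set 'cV[F]_3}}) : F * F :=
  odflt (0, 0) [pick p : F * F | L == perp (row3 1 p.1 p.2)].

Definition rho_hat (F : finFieldType) (L N : {set {set 'cV[F]_3}}) : F :=
  let: (x, y) := line_coord L in
  let: (z, u) := line_coord N in
  x ^+ 2 * u ^+ 2 + y ^+ 2 * z ^+ 2 + (x + z) * (y + u).

(* On the elements of F lying in the field with 2 ^ n elements, this is the
   absolute trace of that field (with values in the prime field {0, 1}). *)
Definition abs_trace (F : finFieldType) (n : nat) (x : F) : F :=
  \sum_(i < n) x ^+ (2 ^ i).

(* In the following, q = 2 ^ h and F has q ^ 2 = 2 ^ (2 * h) elements. *)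

Definition subFq (F : finFieldType) (h : nat) : {set F} :=
  [set x : F | x ^+ (2 ^ h) == x].

Definition setS0 (F : finFieldType) (h : nat) : {set F} :=
  [set x in subFq F h | abs_trace h x == 0].

Definition setS1 (F : finFieldType) (h : nat) : {set F} :=
  subFq F h :\: setS0 F h.

Definition setT0 (F : finFieldType) (h : nat) : {set F} :=
  [set x : F | abs_trace (2 * h) x == 0].

Definition setT1 (F : finFieldType) (h : nat) : {set F} :=
  [set x : F | abs_trace (2 * h) x == 1].

(* R_1, ..., R_5 are indexed from 0. *)
Definition setR (F : finFieldType) (h : nat) (i : 'I_5) : {set F} :=
  nth set0 [:: setS0 F h :\ 0;
               setS1 F h;
               setT0 F h :\: subFq F h;
               [set 0];
               setT1 F h] i.

Definition p4 (F : finFieldType) (h : nat) (l m : {set {set 'cV[F]_3}})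
    (i j : 'I_5) : nat :=
  #|[set n in nontangent_lines F |
      [&& n != l, n != m, rho_hat l n \in setR F h i
        & rho_hat n m \in setR F h j]]|.

(* Rational entries, since q - 3 and r are negative for q = 2. *)
Definition p4_matrix (q : rat) : 'M[rat]_5 :=
  let r := q ^+ 2 - 2 * q - 1 in
  \matrix_(i < 5, j < 5)
    (nth [::]
      [:: [:: (q - 2) * (q - 3) / 2; q * (q - 2) / 2; q * (q - 2) ^+ 2 / 2;
              q - 2; 0];
          [:: q * (q - 2) / 2; q * (q - 1) / 2; q ^+ 2 * (q - 2) / 2;
              q; 0];
          [:: q * (q - 2) ^+ 2 / 2; q ^+ 2 * (q - 2) / 2; q * (q - 2) * r / 2;
              q * (q - 2); 0];
          [:: q - 2; q; q * (q - 2);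
              q ^+ 2 - 1; 0];
          [:: 0; 0; 0;
              0; q ^+ 2 * (q ^+ 2 - 1) / 2]] i)`_j.

Lemma proj_point_in_perp (F : finFieldType) (a : 'rV[F]_3) (v : 'cV[F]_3) :
  v != 0 -> (proj_point v \in perp a) = (a *m v == 0).
Proof.
move=> v0; apply/imsetP/eqP => [[w /[!inE] /andP[_ /eqP aw] vw]|av]; last first.
  by exists v => //; rewrite inE v0 av eqxx.
have: v \in proj_point w.
  by rewrite -vw; apply/imsetP; exists 1; rewrite ?inE ?oner_eq0 ?scale1r.
by case/imsetP=> k _ ->; rewrite -scalemxAr aw scaler0.
Qed.

Lemma row3_mul_col3 (F : finFieldType) (a b c x y z : F) :
  (row3 a b c *m col3 x y z == 0) = (a * x + b * y + c * z == 0).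
Proof.
have E : (row3 a b c *m col3 x y z) 0 0 = a * x + b * y + c * z.
  by rewrite !mxE !big_ord_recr big_ord0 /= !mxE /= add0r.
apply/eqP/eqP => [/matrixP/(_ 0 0)|H]; first by rewrite E mxE.
by apply/matrixP=> i j; rewrite !ord1 E H mxE.
Qed.

Lemma perp1_inj (F : finFieldType) (x y z u : F) :
  perp (row3 1 x y) = perp (row3 1 z u) -> (x, y) = (z, u).
Proof.
move=> e.
have nz1 : col3 (- x) 1 0 != 0.
  by apply/eqP => /matrixP/(_ 1 0)/eqP; rewrite !mxE /= oner_eq0.
have nz2 : col3 (- y) 0 1 != 0.
  by apply/eqP => /matrixP/(_ ord_max 0)/eqP; rewrite !mxE /= oner_eq0.
have := proj_point_in_perp (row3 1 x y) nz1.
have := proj_point_in_perp (row3 1 x y) nz2.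
rewrite e !proj_point_in_perp // !row3_mul_col3 !mul1r !mulr1 !mulr0 !addr0.
rewrite !addNr eqxx !(addrC (- _)) !subr_eq0.
by move=> /eqP-> /eqP->.
Qed.

Lemma rho_hat_perp (F : finFieldType) (x y z u : F) :
  rho_hat (perp (row3 1 x y)) (perp (row3 1 z u)) =
  x ^+ 2 * u ^+ 2 + y ^+ 2 * z ^+ 2 + (x + z) * (y + u).
Proof.
have E (a b : F) : line_coord (perp (row3 1 a b)) = (a, b).
  rewrite /line_coord; case: pickP => [[c d] /eqP /perp1_inj -> //|].
  by move/(_ (a, b)); rewrite eqxx.
by rewrite /rho_hat !E.
Qed.

(* Main.v *)
Require Import Defs.
From mathcomp Require Import all_boot all_order all_algebra all_field.
From mathcomp Require Import ring lra.

Set Implicit Arguments.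
Unset Strict Implicit.
Unset Printing Implicit Defensive.

Import GRing.Theory.
Local Open Scope ring_scope.

(* A non-tangent line (1, x, y)^perp is the binary form x s^2 + s t + y t^2, and
   rho_hat is the resultant, so rho_hat(l, m) = 0 with l <> m means that l and m
   meet in a point of the conic.  Elements of PGL(2, F) preserve the resultant
   and move l, m to the forms s t and s t + t^2.  For n = (1, z, u)^perp one then
   has rho_hat(l, n) = a and rho_hat(n, m) = a + z + z^2 with a = zu, and
   z |-> z + z^2 is two-to-one onto the elements of absolute trace 0. *)

(** * Squaring, traces and the map z |-> z^2 + z in finite fields of characteristic 2 *)

Lemma card_roots_lt_size (F : finFieldType) (p : {poly F}) :
  p != 0 -> (#|[set x | root p x]| < size p)%N.
Proof.
move=> p0; rewrite cardE; apply: max_poly_roots => //; last exact: enum_uniq.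
by apply/allP => x; rewrite mem_enum inE.
Qed.

Section CharTwo.

Variables (F : finFieldType) (char2 : 2%N \in [pchar F]).

(** A certificate for identities modulo 2: [ring] checks that the two sides differ by an explicit
    double [c *+ 2]. *)
Lemma char2_eq (a b c : F) : a - b = c *+ 2 -> a = b.
Proof. by rewrite mulr2n addrr_pchar2 // => /subr0_eq. Qed.

Lemma exprD2n (n : nat) (a b : F) :
  (a + b) ^+ (2 ^ n) = a ^+ (2 ^ n) + b ^+ (2 ^ n).
Proof. by rewrite exprDn_pchar // pnatX (eq_pnat _ (pcharf_eq char2)) pnat_id. Qed.

Lemma sqrrD2 (a b : F) : (a + b) ^+ 2 = a ^+ 2 + b ^+ 2.
Proof. exact: (exprD2n 1). Qed.

Lemma sqr_char2_inj : injective (fun x : F => x ^+ 2).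
Proof.
move=> a b /= e; apply/subr0_eq/eqP; rewrite -sqrf_eq0.
by rewrite oppr_pchar2 // sqrrD2 e addrr_pchar2.
Qed.

Lemma sqr_char2_surj (a : F) : exists b, b ^+ 2 = a.
Proof. by have [g _ gK] := injF_bij sqr_char2_inj; exists (g a); apply: gK. Qed.

Lemma abs_traceD (d : nat) (a b : F) :
  abs_trace d (a + b) = abs_trace d a + abs_trace d b.
Proof. by rewrite -big_split; apply: eq_bigr => i _; rewrite exprD2n. Qed.

Lemma abs_trace_sqr (d : nat) (a : F) :
  abs_trace d (a ^+ 2) = abs_trace d a ^+ 2.
Proof.
elim: d => [|d IH]; first by rewrite /abs_trace !big_ord0 expr0n.
rewrite /abs_trace !big_ord_recr /= -/(abs_trace d _) -/(abs_trace d _).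
by rewrite sqrrD2 IH -!exprM mulnC.
Qed.

(** The powers a^(2^i) with 0 < i < d occur twice and cancel. *)
Lemma abs_trace_telescope (d : nat) (a : F) :
  abs_trace d (a ^+ 2 + a) = a ^+ (2 ^ d) + a.
Proof.
elim: d => [|d IH]; first by rewrite /abs_trace big_ord0 expr1 addrr_pchar2.
rewrite /abs_trace big_ord_recr /= -/(abs_trace d _) IH exprD2n -exprM.
by rewrite -expnS addrC -addrA (addrA (_ ^+ (2 ^ d))) addrr_pchar2 // add0r.
Qed.

(** The trace t of a satisfies t^2 + t = 0, because a^(2^d) + a, the telescoped trace of a^2 + a,
    vanishes on [subFq]. *)
Lemma abs_trace_subFq (d : nat) (a : F) :
  a \in subFq F d -> (abs_trace d a == 0) || (abs_trace d a == 1).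
Proof.
rewrite inE => /eqP aq.
have: abs_trace d (a ^+ 2 + a) = 0.
  by rewrite abs_trace_telescope aq addrr_pchar2.
rewrite abs_traceD abs_trace_sqr expr2 => /eqP.
by rewrite -{3}[abs_trace d a]mulr1 -mulrDr mulf_eq0 addr_eq0 (oppr_pchar2 char2).
Qed.

Lemma subFqD (d : nat) (a b : F) :
  a \in subFq F d -> b \in subFq F d -> a + b \in subFq F d.
Proof. by rewrite !inE exprD2n => /eqP-> /eqP->. Qed.

Lemma subFqX (d n : nat) (a : F) : a \in subFq F d -> a ^+ n \in subFq F d.
Proof. by rewrite !inE -exprM mulnC exprM => /eqP->. Qed.

Lemma artin_schreier_fiber (z w : F) :
  (z ^+ 2 + z == w ^+ 2 + w) = (z \in [set w; w + 1]).
Proof.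
rewrite !inE -subr_eq0 -[z == w]subr_eq0 -[z == w + 1]subr_eq0 -mulf_eq0.
congr (_ == 0); apply: (@char2_eq _ _ ((w + 1) * (z - w))); ring.
Qed.

Lemma artin_schreier_pair_neq (w : F) : w != w + 1.
Proof. by rewrite -subr_eq0 opprD addrA subrr sub0r oppr_eq0 oner_eq0. Qed.

Lemma card_subFq_le (d : nat) : (0 < d)%N -> (#|subFq F d| <= 2 ^ d)%N.
Proof.
move=> d0; have sz : size ('X^(2 ^ d) - 'X : {poly F}) = (2 ^ d).+1.
  by rewrite size_polyDl ?size_polyXn // size_polyN size_polyX ltnS (ltn_exp2l 0).
have p0 : ('X^(2 ^ d) - 'X : {poly F}) != 0 by rewrite -size_poly_eq0 sz.
rewrite -ltnS -sz; apply: leq_trans (card_roots_lt_size p0).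
rewrite ltnS; apply/subset_leq_card/subsetP => x; rewrite !inE => /eqP xq.
by rewrite rootE !hornerE xq subrr.
Qed.

(** The trace is a polynomial function of degree 2^d, its top term being the last of the [d.+1]
    summands. *)
Lemma card_trace_zero_le (d : nat) :
  (#|setS0 F d.+1| <= 2 ^ d)%N.
Proof.
pose p : {poly F} := \sum_(i < d.+1) 'X^(2 ^ i).
have sz : size p = (2 ^ d).+1.
  rewrite /p big_ord_recr /= addrC size_polyDl size_polyXn //.
  apply: leq_ltn_trans (size_sum _ _ _) _; apply/bigmax_leqP => i _.
  by rewrite size_polyXn ltn_exp2l.
have p0 : p != 0 by rewrite -size_poly_eq0 sz.
rewrite -ltnS -sz; apply: leq_trans (card_roots_lt_size p0).
rewrite ltnS; apply/subset_leq_card/subsetP => x; rewrite !inE => /andP[_ xt].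
rewrite rootE horner_sum; congr (_ == 0): xt.
by apply: eq_bigr => i _; rewrite hornerXn.
Qed.

(** A squeeze: the image lies in the trace-zero set by telescoping, has at least 2^d elements
    because the fibres have at most two, and the trace-zero set has at most 2^d. *)
Lemma artin_schreier_image (d : nat) : #|subFq F d.+1| = (2 ^ d.+1)%N ->
  setS0 F d.+1 = [set z ^+ 2 + z | z in subFq F d.+1]
  /\ #|setS0 F d.+1| = (2 ^ d)%N.
Proof.
set T := setS0 F _; set A := subFq F d.+1; set I := [set _ | z in _].
move=> cA; have sIT : I \subset T.
  apply/subsetP => _ /imsetP[z zA ->]; rewrite inE.
  rewrite subFqD ?subFqX //= abs_trace_telescope.
  by move: zA; rewrite inE => /eqP->; rewrite addrr_pchar2.
have cI : (2 ^ d <= #|I|)%N.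
  rewrite -(leq_pmul2l (isT : 0 < 2)%N) -expnS -cA.
  rewrite -sum1_card (partition_big_imset (fun z => z ^+ 2 + z)) /= mulnC.
  rewrite -sum_nat_const; apply: leq_sum => _ /imsetP[w wA ->].
  rewrite sum1dep_card; apply: (@leq_trans #|[set w; w + 1]|); last first.
    by rewrite cards2; case: (_ != _).
  apply/subset_leq_card/subsetP => z; rewrite !inE => /andP[_].
  by rewrite artin_schreier_fiber !inE.
have e : I = T.
  by apply/eqP; rewrite eqEcard sIT (leq_trans (card_trace_zero_le d) cI).
split=> //; rewrite -e.
by apply/eqP; rewrite eqn_leq cI e card_trace_zero_le.
Qed.

Lemma card_subFq (h : nat) : (0 < h)%N -> #|F| = (2 ^ (2 * h))%N ->
  #|subFq F h| = (2 ^ h)%N.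
Proof.
move=> h0 cF; apply/eqP; rewrite eqn_leq card_subFq_le //=.
pose f (x : F) := x ^+ (2 ^ h) + x.
have fq x : f x \in subFq F h.
  by rewrite inE exprD2n -exprM -expnD addnn -mul2n -cF expf_card addrC.
(* f is additive with kernel F_q and image in F_q. *)
have : (#|F| <= #|subFq F h| * #|subFq F h|)%N.
  rewrite -(sum1_card F) (partition_big f [in subFq F h]) /=;
    last by move=> x _; apply: fq.
  rewrite -sum_nat_const; apply: leq_sum => y _.
  rewrite sum1dep_card; have [->|[w]] := set_0Vmem [set x | f x == y].
    by rewrite cards0.
  rewrite inE => /eqP <-.
  (* A nonempty fibre of [f] lies in the translate by one of its points [w] of the kernel
     [subFq F h]. *)
  apply: leq_trans (leq_imset_card (+%R w) _).
  apply/subset_leq_card/subsetP => x.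
  rewrite inE => /eqP e; apply/imsetP; exists (x - w); last by rewrite addrC subrK.
  rewrite inE -subr_eq0 !(oppr_pchar2 char2) exprD2n.
  by rewrite addrACA -/(f x) -/(f w) e addrr_pchar2.
rewrite cF mul2n -addnn expnD => le.
by rewrite -leq_sqr -!mulnn.
Qed.

End CharTwo.

(** * The resultant on coordinate pairs, its isometries, and the count in normal position *)

Definition rho_pair (F : finFieldType) (p n : F * F) : F :=
  p.1 ^+ 2 * n.2 ^+ 2 + p.2 ^+ 2 * n.1 ^+ 2 + (p.1 + n.1) * (p.2 + n.2).

(** On the finite type [F * F] injectivity already gives a bijection, so counts can be transported
    along [g]. *)
Definition isometry (F : finFieldType) (g : F * F -> F * F) : Prop :=
  injective g /\ forall p n, rho_pair (g p) (g n) = rho_pair p n.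

Lemma isometry_comp (F : finFieldType) (f g : F * F -> F * F) :
  isometry f -> isometry g -> isometry (f \o g).
Proof.
by move=> [fi fr] [gi gr]; split=> [|p n]; [apply: inj_comp | rewrite /= fr gr].
Qed.

(* The substitutions s := s + c t, s <-> t and (s, t) := (k s, t) / sqrt k. *)
Definition translate_form (F : finFieldType) (c : F) (p : F * F) : F * F :=
  (p.1, p.2 + c + p.1 * c ^+ 2).

Definition swap_form (F : finFieldType) (p : F * F) : F * F := (p.2, p.1).

Definition scale_form (F : finFieldType) (k : F) (p : F * F) : F * F :=
  (p.1 * k, p.2 / k).

Section Isometries.

Variables (F : finFieldType) (char2 : 2%N \in [pchar F]).

Lemma isometry_translate (c : F) : isometry (translate_form c).
Proof.
have two0 : 2%:R = 0 :> F by apply: pcharf0.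
split=> [[x y] [z u] [-> /addIr /addIr ->] //|[x y] [z u]].
by rewrite /rho_pair /=; ring: two0.
Qed.

Lemma isometry_swap : isometry (@swap_form F).
Proof.
split=> [[x y] [z u] [-> ->] //|[x y] [z u]].
by rewrite /rho_pair /=; ring.
Qed.

Lemma isometry_scale (k : F) : k != 0 -> isometry (scale_form k).
Proof.
move=> k0; split=> [[x y] [z u] [/(mulIf k0) -> /mulIf -> //]|[x y] [z u]].
  by rewrite invr_eq0.
by rewrite /rho_pair /=; field.
Qed.

(** A vanishing resultant gives a common zero of the two forms on the projective line: (1 : 0) in
    the first case, (c : 1) in the second. *)
Lemma common_root (l m : F * F) : l != m -> rho_pair l m = 0 ->
  (l.1 = 0 /\ m.1 = 0) \/
  exists c, l.1 * c ^+ 2 + c + l.2 = 0 /\ m.1 * c ^+ 2 + c + m.2 = 0.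
Proof.
have two0 : 2%:R = 0 :> F by apply: pcharf0.
case: l m => [x y] [x' y'] lm; rewrite /rho_pair /= => r0.
have [xx|xx] := eqVneq x x'; [left|right].
  have yy : y + y' != 0.
    by rewrite addr_eq0 oppr_pchar2 //; apply: contra lm => /eqP->; rewrite xx.
  suff : (x * (y + y')) ^+ 2 = 0.
    by move/eqP; rewrite sqrf_eq0 mulf_eq0 (negPf yy) orbF -xx => /eqP.
  by rewrite -r0 -xx; ring: two0.
have xx0 : x + x' != 0 by rewrite addr_eq0 oppr_pchar2.
(* Eliminating c^2 from the two equations forces this c, and adding them forces c^2 = (y + y') / (x
   + x'). The two values agree exactly because the resultant is 0. *)
have c2 : ((x * y' + x' * y) / (x + x')) ^+ 2 = (y + y') / (x + x').
  apply/eqP; rewrite expr_div_n eqr_div ?expf_neq0 // -subr_eq0.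
  apply/eqP; transitivity ((x + x') * (x ^+ 2 * y' ^+ 2 + y ^+ 2 * x' ^+ 2
    + (x + x') * (y + y'))); last by rewrite r0 mulr0.
  by rewrite oppr_pchar2 //; ring: two0.
exists ((x * y' + x' * y) / (x + x')); rewrite c2.
split; apply: (mulIf xx0); rewrite mul0r.
  transitivity (x * (y + y') + (x * y' + x' * y) + y * (x + x')); first by field.
  by ring: two0.
transitivity (x' * (y + y') + (x * y' + x' * y) + y' * (x + x')); first by field.
by ring: two0.
Qed.

(* The three points of P^1 underlying l and m are moved to oo, 0 and 1. *)
Lemma isometry_normal_form (l m : F * F) : l != m -> rho_pair l m = 0 ->
  exists g, [/\ isometry g, g l = (0, 0) & g m = (0, 1)].
Proof.
(* If both forms vanish at (1 : 0), a translation makes the other zero of [p] equal to 0, and a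
   scaling then moves that of [n] to 1. *)
have at_infinity (p n : F * F) : p != n -> p.1 = 0 -> n.1 = 0 ->
    exists g, [/\ isometry g, g p = (0, 0) & g n = (0, 1)].
  case: p n => [? y] [? y'] /= yy xe ze; rewrite {}xe {}ze in yy *.
  have k0 : y' + y != 0.
    rewrite addr_eq0 oppr_pchar2 //.
    by apply: contra yy => /eqP->.
  exists (scale_form (y' + y) \o translate_form y); split.
  - exact: isometry_comp (isometry_scale k0) (isometry_translate y).
  - by rewrite /scale_form /= !mul0r addr0 addrr_pchar2 // mul0r.
  - by rewrite /scale_form /= !mul0r addr0 divff.
move=> lm /(common_root lm)[[]|[c [lc mc]]]; first exact: at_infinity.
have [ti tr] := isometry_comp isometry_swap (isometry_translate c).
(* Translation by c makes the value of the form at (c : 1) its t^2 coefficient, and the swap makes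
   this the s^2 coefficient; thus the common zero goes to (1 : 0). *)
have eqc p : p.1 * c ^+ 2 + c + p.2 = 0 ->
    ((@swap_form F \o translate_form c) p).1 = 0.
  by move=> <-; rewrite /=; ring.
have [|g [gi gl gm]] := at_infinity _ _ _ (eqc _ lc) (eqc _ mc).
  by rewrite (inj_eq ti).
by exists (g \o (@swap_form F \o translate_form c)); split=> //;
  apply: isometry_comp.
Qed.

(* The last term counts the lines through (0, 1, 0), those with z = 0. *)
Lemma card_normal_form (T A B : {set F}) : T = [set z ^+ 2 + z | z : F] ->
  (#|[set n : F * F | [&& n != (0%R, 0%R), n != (0%R, 1%R),
       rho_pair (0%R, 0%R) n \in A & rho_pair n (0%R, 1%R) \in B]]|
     + #|A :&: B|
   = 2 * #|[set p : F * F | [&& p.1 \in A, p.2 \in B & (p.1 + p.2)%R \in T]]|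
     + (#|F| - 2) * (0%R \in A :&: B))%N.
Proof.
move=> TE; set N := [set n | _]; set P := [set p | _].
pose Z := [set n : F * F | n.1 == 0].
(* Elements of [E] are pairs (a, z) with a = zu, from which u is recovered when z is nonzero. The
   pairs (a, 0), which come from no line, number [#|A :&: B|] and are the correction on the left of
   the statement. *)
pose E := [set p : F * F | (p.1 \in A) && (p.1 + (p.2 ^+ 2 + p.2) \in B)].
pose Z' := [set p : F * F | p.2 == 0].
(* For z = 0 both values of [rho_pair] are 0, so either every u except 0 and 1 (the two given lines)
   is counted, or none is. *)
have cNZ : #|N :&: Z| = ((#|F| - 2) * (0%R \in A :&: B))%N.
  have [AB|AB] := boolP (0 \in A :&: B); last first.
    rewrite muln0; apply/eqP; rewrite cards_eq0; apply/eqP/setP => -[z u].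
    rewrite !inE; apply/negP => /andP[/and4P[_ _ nA nB] /= /eqP z0].
    case/negP: AB; rewrite inE; apply/andP; split.
      by move: nA; rewrite /rho_pair z0 /= !(expr0n, mul0r, mulr0, addr0).
    by move: nB; rewrite /rho_pair z0 /= !(expr0n, mul0r, mulr0, addr0).
  rewrite muln1; have <- : #|~: [set 0; 1 : F]| = (#|F| - 2)%N.
    by rewrite -(cardsC [set 0; 1]) cards2 eq_sym oner_eq0 addKn.
  rewrite -(card_imset _ (_ : injective (fun u : F => (0 : F, u)))); last first.
    by move=> u v [].
  apply: eq_card => -[z u]; rewrite !inE /= /rho_pair /=.
  apply/idP/imsetP => [/andP[/and4P[n0 n1 _ _] /eqP z0]|[v]].
    rewrite z0 in n0 n1 *; exists u => //; rewrite !inE.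
    by apply/norP; split; [apply: contra n0 | apply: contra n1] => /eqP->.
  rewrite !inE => /norP[v0 v1] [-> ->]; rewrite !xpair_eqE !eqxx /= v0 v1.
  by rewrite !(expr0n, mul0r, mulr0, addr0) /=; move: AB; rewrite inE => /andP[-> ->].
have cND : #|N :\: Z| = #|E :\: Z'|.
  rewrite -(@card_in_imset _ _ (fun p : F * F => (p.2, p.1 / p.2)) (E :\: Z')).
    apply: eq_card => -[z u]; rewrite !inE /=; apply/idP/imsetP.
      case/andP=> z0 /and4P[_ _ nA nB]; exists (z * u, z); last first.
        by rewrite /= mulrAC divff // mul1r.
      rewrite !inE /= z0 /=; apply/andP; split.
        by congr (_ \in A): nA; rewrite /rho_pair /=; ring.
      by congr (_ \in B): nB; rewrite /rho_pair /=; ring.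
    case=> -[a w]; rewrite !inE /= => /andP[w0 /andP[aA aB]] [-> ->].
    rewrite w0 !xpair_eqE (negPf w0) /=; apply/andP; split.
      by congr (_ \in A): aA; rewrite /rho_pair /=; field.
    by congr (_ \in B): aB; rewrite /rho_pair /=; field.
  move=> [a z] [b w]; rewrite !inE /= => /andP[z0 _] _ [<-].
  by rewrite -[z^-1]invrK => /mulIf -> //; rewrite !invr_eq0.
have cEZ : #|E :&: Z'| = #|A :&: B|.
  rewrite -(card_imset _ (_ : injective (fun a : F => (a, 0 : F)))); last first.
    by move=> u v [].
  apply: eq_card => -[a z]; rewrite !inE /=; apply/idP/imsetP.
    case/andP=> + /eqP z0; rewrite z0 expr0n /= !addr0 => ab.
    by exists a => //; rewrite inE.
  by case=> b; rewrite inE => ab [-> ->]; rewrite expr0n /= !addr0 ab eqxx.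
(* The map (a, z) |-> (a, a + z^2 + z) from [E] onto [P] has fibres {(a, w), (a, w + 1)};
   surjectivity is where [TE] enters. *)
have cE : #|E| = (2 * #|P|)%N.
  rewrite -sum1_card.
  rewrite (partition_big (fun p : F * F => (p.1, p.1 + (p.2 ^+ 2 + p.2)))
             [in P]) /=; last first.
    move=> [a z]; rewrite !inE /= => /andP[-> ->] /=.
    by rewrite addrA addrr_pchar2 // add0r TE; apply/imsetP; exists z.
  rewrite mulnC -sum_nat_const; apply: eq_bigr => -[a b].
  rewrite inE /= => /and3P[aA bB]; rewrite TE => /imsetP[w _ e].
  have be : b = a + (w ^+ 2 + w) by rewrite -e addrA addrr_pchar2 // add0r.
  rewrite sum1dep_card.
  transitivity #|[set (a, w); (a, w + 1)]|; last first.
    by rewrite cards2 xpair_eqE eqxx artin_schreier_pair_neq.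
  apply: eq_card => -[a' z]; rewrite !inE /= !xpair_eqE.
  have [->|//] := eqVneq a' a; last by rewrite andbF.
  rewrite aA /= be (inj_eq (addrI a)) artin_schreier_fiber // in_set2 andb_idl //.
  by rewrite -in_set2 -artin_schreier_fiber // => /eqP->; rewrite -be.
by rewrite -(cardsID Z N) cNZ cND -cEZ -addnA [(#|E :\: _| + _)%N]addnC cardsID cE addnC.
Qed.

End Isometries.

(** * Incidence with the conic, parametrised by the projective line with [None] as infinity *)

Definition conic_point (F : finFieldType) (o : option F) : {set 'cV[F]_3} :=
  if o is Some xi then proj_point (col3 xi (xi ^+ 2) 1)
  else proj_point (col3 0 1 0).

Definition line_of (F : finFieldType) (p : F * F) : {set {set 'cV[F]_3}} :=
  perp (row3 1 p.1 p.2).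

Lemma line_of_inj (F : finFieldType) : injective (@line_of F).
Proof. by move=> [x y] [z u] /perp1_inj. Qed.

Lemma rho_hat_line_of (F : finFieldType) (p n : F * F) :
  rho_hat (line_of p) (line_of n) = rho_pair p n.
Proof. exact: rho_hat_perp. Qed.

Lemma proj_point_eq (F : finFieldType) (v w : 'cV[F]_3) :
  proj_point v = proj_point w -> exists k, v = k *: w.
Proof.
move=> vw; have : v \in proj_point w.
  by rewrite -vw; apply/imsetP; exists 1; rewrite ?inE ?oner_eq0 ?scale1r.
by case/imsetP => k _ ->; exists k.
Qed.

Lemma col3_inj (F : finFieldType) (a b c a' b' c' : F) :
  col3 a b c = col3 a' b' c' -> [/\ a = a', b = b' & c = c'].
Proof.
move=> /matrixP e; have := (e 0 0, e 1 0, e ord_max 0).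
by rewrite !mxE /= => -[[-> ->] ->].
Qed.

Lemma scale_col3 (F : finFieldType) (k a b c : F) :
  k *: col3 a b c = col3 (k * a) (k * b) (k * c).
Proof. by apply/matrixP => -[[|[|[|]]] //= ?] j; rewrite !mxE. Qed.

Lemma col3_eq0 (F : finFieldType) (a b c : F) :
  (col3 a b c == 0) = [&& a == 0, b == 0 & c == 0].
Proof.
have e0 : col3 0 0 0 = 0 :> 'cV[F]_3.
  by apply/matrixP => -[[|[|[|]]] //= ?] j; rewrite !mxE.
apply/eqP/and3P => [|[/eqP-> /eqP-> /eqP->] //].
by rewrite -e0 => /col3_inj[-> -> ->].
Qed.

Lemma conic_point_inj (F : finFieldType) : injective (@conic_point F).
Proof.
have inf (xi k : F) : col3 xi (xi ^+ 2) 1 = k *: col3 0 1 0 -> False.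
  rewrite scale_col3 => /col3_inj[_ _ /eqP].
  by rewrite mulr0 oner_eq0.
move=> [xi|] [eta|] //= /proj_point_eq[k].
- rewrite scale_col3 => /col3_inj[-> _].
  by rewrite mulr1 => <-; rewrite mul1r.
- by move/inf.
- rewrite scale_col3 => /col3_inj[_ /eqP + /eqP].
  by rewrite mulr1 => + /eqP k0; rewrite -k0 mul0r oner_eq0.
Qed.

(** For the line (1, x, y) this identifies its conic points with the zeros of x s^2 + s t + y t^2:
    [Some xi] is (xi : 1) and [None] is (1 : 0). *)
Lemma conic_point_in_perp (F : finFieldType) (a b c : F) (o : option F) :
  (conic_point o \in perp (row3 a b c)) =
    if o is Some xi then a * xi + b * xi ^+ 2 + c == 0 else b == 0.
Proof.
case: o => [xi|]; rewrite proj_point_in_perp ?row3_mul_col3.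
- by rewrite mulr1.
- by rewrite col3_eq0 oner_eq0 !andbF.
- by rewrite !mulr0 mulr1 addr0 add0r.
- by rewrite col3_eq0 oner_eq0 andbF.
Qed.

Lemma conicE (F : finFieldType) : conic F = [set conic_point o | o : option F].
Proof.
apply/setP => P; rewrite !inE; apply/orP/imsetP.
  case=> [/eqP->|/imsetP[xi _ ->]]; first by exists None.
  by exists (Some xi).
case=> -[xi|] _ ->; last by left.
by right; apply/imsetP; exists xi.
Qed.

Lemma card_perp_conic (F : finFieldType) (a b c : F) :
  #|perp (row3 a b c) :&: conic F| =
    ((b == 0%R) + #|[set xi : F | (a * xi + b * xi ^+ 2 + c == 0)%R]|)%N.
Proof.
have -> : perp (row3 a b c) :&: conic F =
    [set conic_point o | o in [set o | conic_point o \in perp (row3 a b c)]].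
  apply/setP => P; rewrite conicE inE; apply/andP/imsetP.
    by case=> PL /imsetP[o _ e]; exists o; rewrite ?inE -?e.
  case=> o; rewrite inE => oL ->; split=> //.
  by apply/imsetP; exists o.
rewrite (card_imset _ (@conic_point_inj F)).
rewrite (cardsD1 None) inE conic_point_in_perp; congr (_ + _)%N.
rewrite -[RHS](card_imset _ (@Some_inj _)); apply: eq_card => -[xi|].
  rewrite !inE conic_point_in_perp; apply/idP/imsetP => [xi0|].
    by exists xi; rewrite ?inE.
  by case=> eta; rewrite inE => ? [->].
by rewrite !inE; apply/esym/imsetP => -[].
Qed.

Lemma perp_scale (F : finFieldType) (k : F) (a : 'rV[F]_3) :
  k != 0 -> perp (k *: a) = perp a.
Proof.
move=> k0; apply/setP => P; apply/imsetP/imsetP => -[v vP ->];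
  by exists v => //; move: vP; rewrite !inE -scalemxAl scaler_eq0 (negPf k0).
Qed.

Lemma row3_eta (F : finFieldType) (a : 'rV[F]_3) :
  a = row3 (a 0 0) (a 0 1) (a 0 ord_max).
Proof.
by apply/matrixP => i -[[|[|[|]]] //= p]; rewrite !mxE !ord1; congr (a _ _);
   apply: val_inj.
Qed.

Lemma scale_row3 (F : finFieldType) (k a b c : F) :
  k *: row3 a b c = row3 (k * a) (k * b) (k * c).
Proof. by apply/matrixP => i -[[|[|[|]]] //= ?]; rewrite !mxE. Qed.

Lemma row3_0 (F : finFieldType) : row3 0 0 0 = 0 :> 'rV[F]_3.
Proof. by apply/matrixP => i -[[|[|[|]]] //= ?]; rewrite !mxE. Qed.

(** * Non-tangent lines in characteristic 2 *)

Section NonTangent.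

Variables (F : finFieldType) (char2 : 2%N \in [pchar F]).

(** The s t coefficient is 1, so the form has no double zero: a zero w has the distinct companion w
    + 1/x, and for x = 0 the zeros are infinity and -y. *)
Lemma card_line_of_conic (p : F * F) :
  (#|line_of p :&: conic F| == 2%N) || (#|line_of p :&: conic F| == 0%N).
Proof.
case: p => x y; rewrite card_perp_conic /=.
have [->|x0] := eqVneq x 0.
  rewrite (_ : [set _ | _] = [set - y]) ?cards1 //; apply/setP => xi.
  by rewrite !inE mul0r addr0 mul1r addr_eq0.
have [->|[w]] := set_0Vmem [set xi : F | 1 * xi + x * xi ^+ 2 + y == 0].
  by rewrite cards0.
rewrite inE mul1r addrC addr_eq0 => /eqP yE.
rewrite (_ : [set _ | _] = [set w; w + x^-1]); last first.
  apply/setP => xi; rewrite !inE -[xi == w]subr_eq0 -[xi == w + _]subr_eq0.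
  rewrite -mulf_eq0 -[RHS](mulrI_eq0 _ (mulfI x0)) yE; congr (_ == 0).
  by apply: (char2_eq char2 (c := (xi - w) * (x * w + 1))); field.
rewrite cards2 -subr_eq0 opprD addrA subrr sub0r oppr_eq0 invr_eq0 x0.
by rewrite eqxx.
Qed.

Lemma line_of_nontangent (p : F * F) : line_of p \in nontangent_lines F.
Proof.
have pl : line_of p \in lines F.
  apply/imsetP; exists (row3 1 p.1 p.2) => //; rewrite inE.
  by apply/eqP => /matrixP/(_ 0 0)/eqP; rewrite !mxE oner_eq0.
by rewrite !inE pl /= card_line_of_conic.
Qed.

Lemma secant_of_conic_point (o : option F) (p : F * F) :
  conic_point o \in line_of p -> line_of p \in secant_lines F.
Proof.
move=> op; have := line_of_nontangent p; rewrite in_setU => /orP[//|].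
rewrite inE cards_eq0 => /andP[_ /eqP L0]; have := in_set0 (conic_point o).
by rewrite -L0 inE op conicE imset_f.
Qed.

(** A line (0, b, c) is tangent: if b = 0 it meets the conic only at [None], and otherwise b xi^2 +
    c = 0 has exactly one solution because squaring is bijective. Any other line is rescaled to
    first coordinate 1. *)
Lemma nontangent_line_of (L : {set {set 'cV[F]_3}}) :
  L \in nontangent_lines F -> exists p, L = line_of p.
Proof.
rewrite in_setU => Lnt; have /imsetP[a] : L \in lines F.
  by case/orP: Lnt; rewrite inE => /andP[].
have : #|L :&: conic F| != 1%N.
  by case/orP: Lnt; rewrite inE => /andP[_ /eqP->].
move=> {Lnt} + + LE; rewrite {}LE (row3_eta a).
rewrite inE; move: (a 0 0) (a 0 1) (a 0 ord_max) => x b c; rewrite card_perp_conic.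
have [-> L1 /eqP abc|x0 _ _] := eqVneq x 0; last first.
  exists (b / x, c / x); rewrite -(perp_scale _ (invr_neq0 x0)) scale_row3.
  by rewrite mulVf // ![x^-1 * _]mulrC.
case/eqP: L1; have [b0|b0] := eqVneq b 0.
  rewrite b0 in abc *; rewrite (_ : [set _ | _] = set0) ?cards0 //.
  apply/setP => xi; rewrite !inE !mul0r !add0r; apply/eqP => c0.
  by apply: abc; rewrite c0 row3_0.
have [s sE] := sqr_char2_surj char2 (c / b).
rewrite (_ : [set _ | _] = [set s]) ?cards1 //; apply/setP => xi.
rewrite !inE mul0r add0r -[RHS](inj_eq (sqr_char2_inj char2)) /= sE.
rewrite addr_eq0 oppr_pchar2 //.
by apply/eqP/eqP => [<-|->]; [rewrite mulrC mulKf | rewrite mulrC divfK].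
Qed.

(** The common zero of the two forms is a conic point on both lines, so neither line is exterior. *)
Lemma secant_of_rho0 (l m : F * F) : l != m -> rho_pair l m = 0 ->
  line_of l \in secant_lines F /\ line_of m \in secant_lines F.
Proof.
move=> lm /(common_root char2 lm)[[l0 m0]|[c [lc mc]]].
  by split; apply: (@secant_of_conic_point None);
     rewrite conic_point_in_perp ?l0 ?m0.
by split; apply: (@secant_of_conic_point (Some c));
   rewrite conic_point_in_perp mul1r [c + _]addrC ?lc ?mc.
Qed.

End NonTangent.

(** * The sets R_i as a partition of the field, their sizes, and the count in closed form *)

Section Classes.

Variables (F : finFieldType) (h : nat).
Hypotheses (h_gt0 : (0 < h)%N) (cardF : #|F| = (2 ^ (2 * h))%N).

Let char2 : 2%N \in [pchar F]. Proof. exact: card_finPcharP cardF _. Qed.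

Let h1 : h.-1.+1 = h. Proof. exact: prednK. Qed.

Lemma subFq_full : subFq F (2 * h) = setT.
Proof. by apply/setP => x; rewrite !inE -cardF expf_card eqxx. Qed.

Lemma setT0E : setT0 F h = setS0 F (2 * h).
Proof. by apply/setP => x; rewrite !inE -cardF expf_card eqxx. Qed.

Lemma setT0_image : setT0 F h = [set z ^+ 2 + z | z : F].
Proof.
have h2 : (2 * h).-1.+1 = (2 * h)%N by rewrite prednK // muln_gt0.
rewrite setT0E -h2; have [|-> _] := @artin_schreier_image _ char2 (2 * h).-1.
  by rewrite h2 subFq_full cardsT.
rewrite h2 subFq_full; apply/setP => x.
by apply/imsetP/imsetP => -[z _ ->]; exists z.
Qed.

Lemma card_setT0 : #|setT0 F h| = (2 * (2 ^ h.-1) ^ 2)%N.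
Proof.
have h2 : (2 * h).-1.+1 = (2 * h)%N by rewrite prednK // muln_gt0.
rewrite setT0E -h2; have [|_ ->] := @artin_schreier_image _ char2 (2 * h).-1.
  by rewrite h2 subFq_full cardsT.
by rewrite -expnM -expnS; congr (2 ^ _)%N; rewrite -{1}h1 mulnS mulnC.
Qed.

Lemma card_setS0 : #|setS0 F h| = (2 ^ h.-1)%N.
Proof.
rewrite -{1}h1; have [|_ ->//] := @artin_schreier_image _ char2 h.-1.
by rewrite h1 card_subFq.
Qed.

Lemma zero_in_setS0 : 0 \in setS0 F h.
Proof.
rewrite !inE expr0n expn_eq0 eqxx /=.
by rewrite /abs_trace big1 // => i _; rewrite expr0n expn_eq0.
Qed.

Lemma setS0_sub : setS0 F h \subset subFq F h.
Proof. by apply/subsetP => x; rewrite inE => /andP[]. Qed.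

(** On F_q the 2h summands of the trace repeat with period h, so the trace is twice the trace over
    F_q. *)
Lemma subFq_sub : subFq F h \subset setT0 F h.
Proof.
apply/subsetP => x; rewrite !inE => /eqP xq.
rewrite /abs_trace mul2n -addnn big_split_ord /= -/(abs_trace h x).
rewrite [X in _ + X](_ : _ = abs_trace h x) ?addrr_pchar2 //.
by apply: eq_bigr => i _; rewrite expnD exprM xq.
Qed.

Lemma setT0D (x y : F) :
  (x + y \in setT0 F h) = ((x \in setT0 F h) == (y \in setT0 F h)).
Proof.
have t01 (z : F) : (abs_trace (2 * h) z == 0) || (abs_trace (2 * h) z == 1).
  by apply: abs_trace_subFq => //; rewrite subFq_full inE.
rewrite !inE abs_traceD //.
by case/orP: (t01 x) => /eqP->; case/orP: (t01 y) => /eqP->;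
  rewrite ?addr0 ?add0r ?addrr_pchar2 ?eqxx ?oner_eq0.
Qed.

Lemma setT1E : setT1 F h = ~: setT0 F h.
Proof.
apply/setP => x; rewrite !inE.
have := @abs_trace_subFq _ char2 (2 * h) x; rewrite subFq_full inE => /(_ isT).
by case/orP => /eqP->; rewrite ?eqxx ?oner_eq0 // eq_sym oner_eq0.
Qed.

(** The chain {0}, S_0, F_q, T_0, F is increasing and R_1, ..., R_5 are its successive differences
    in another order; the value is the position, from 0, of the class containing x. *)
Definition class_index (x : F) : nat :=
  if x \notin setT0 F h then 4 else if x \notin subFq F h then 2
  else if x \notin setS0 F h then 1 else if x == 0 then 3 else 0.

Lemma in_setR (i : 'I_5) (x : F) : (x \in setR F h i) = (class_index x == i).
Proof.
have S0 : x == 0 -> x \in setS0 F h by move=> /eqP->; apply: zero_in_setS0.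
have SF := subsetP setS0_sub x; have FT := subsetP subFq_sub x.
rewrite /class_index /setR; case: i => [[|[|[|[|[|//]]]]] p] /=;
  rewrite ?setT1E ?(in_setD, in_setC, in_set1);
  move: S0 SF FT; case: (x == 0); case: (x \in setS0 F h);
  case: (x \in subFq F h); case: (x \in setT0 F h) => //= S0 SF FT;
  by [have := S0 isT | have := SF isT | have := FT isT].
Qed.

(** With k = q/2 every size is an integer polynomial in k; rational values avoid truncated
    subtraction. *)
Lemma card_setR (i : 'I_5) : #|setR F h i|%:R =
  (let k := (2 ^ h.-1)%:R in
   [:: k - 1; k; 2 * k ^+ 2 - 2 * k; 1; 2 * k ^+ 2]`_i) :> rat.
Proof.
have k2 : (2 ^ h = 2 * 2 ^ h.-1)%N by rewrite -expnS h1.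
have cq : #|subFq F h| = (2 * 2 ^ h.-1)%N by rewrite card_subFq.
rewrite /setR; case: i => [[|[|[|[|[|//]]]]] p] /=.
- by rewrite -card_setS0 (cardsD1 0 (setS0 F h)) zero_in_setS0 natrD addrAC subrr add0r.
- rewrite cardsDS ?setS0_sub // cq card_setS0 mul2n -addnn addnK //.
- rewrite cardsDS ?subFq_sub // natrB ?subset_leq_card ?subFq_sub //.
  by rewrite cq card_setT0 !natrM natrX.
- by rewrite cards1.
- rewrite setT1E cardsCs setCK cardF card_setT0 natrB.
    by rewrite mulnC expnM k2 !natrX !natrM natrX; ring.
  by rewrite -card_setT0 -cardF max_card.
Qed.

(** Whether a + b has trace 0 depends only on the classes of a and b: either all pairs of R_i x R_j
    qualify or none, according to whether both or neither of the classes is T_1. The other terms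
    reflect that the classes are disjoint and that 0 lies only in the class of index 3. *)
Lemma p4_line_of (l m : F * F) (i j : 'I_5) : l != m -> rho_pair l m = 0 ->
  (p4 h (line_of l) (line_of m) i j + (i == j) * #|setR F h i|
   = 2 * (((i == 4 :> nat) == (j == 4 :> nat)) * (#|setR F h i| * #|setR F h j|))
     + (#|F| - 2) * ((i == 3 :> nat) && (j == 3 :> nat)))%N.
Proof.
move=> lm r0; have [g [[gi gr] gl gm]] := isometry_normal_form char2 lm r0.
set A := setR F h i; set B := setR F h j.
(* [line_of] replaces lines by pairs, and [g] moves l and m to (0, 0) and (0, 1). *)
have -> : p4 h (line_of l) (line_of m) i j =
    #|[set n : F * F | [&& n != (0, 0), n != (0, 1),
       rho_pair (0, 0) n \in A & rho_pair n (0, 1) \in B]]|.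
  rewrite -(card_preimset _ gi) -(card_imset _ (@line_of_inj F)).
  apply: eq_card => L; rewrite inE; apply/idP/imsetP.
    case/andP=> /(nontangent_line_of char2)[n ->].
    rewrite !rho_hat_line_of !(inj_eq (@line_of_inj F)) => nE.
    by exists n => //; rewrite !inE -gl -gm !gr !(inj_eq gi).
  case=> n; rewrite !inE -gl -gm !gr !(inj_eq gi) => nE ->.
  rewrite !rho_hat_line_of !(inj_eq (@line_of_inj F)) nE andbT.
  by have := line_of_nontangent char2 n; rewrite !inE.
have c0 : class_index 0 = 3.
  have := in_setR (Ordinal (isT : 3 < 5)%N) 0.
  by rewrite inE eqxx => /esym/eqP.
have -> : ((i == j) * #|A|)%N = #|A :&: B|.
  have [eij|ij] := eqVneq i j; first by rewrite mul1n /B -eij setIid.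
  rewrite mul0n; apply/esym/eqP; rewrite cards_eq0; apply/eqP/setP => x.
  rewrite in_setI !in_setR in_set0; apply/negP => /andP[/eqP-> /eqP/val_inj].
  by apply/eqP.
rewrite (card_normal_form char2 _ _ setT0_image); congr (2 * _ + _ * _)%N.
  rewrite -cardsX; have T4 x : (x \in setT0 F h) = (class_index x != 4).
    have := in_setR (Ordinal (isT : 4 < 5)%N) x.
    by rewrite /setR /= setT1E inE => <-; rewrite negbK.
  have [e|ne] := eqVneq (i == 4 :> nat) (j == 4 :> nat).
    rewrite mul1n; apply: eq_card => -[x y]; rewrite in_setX inE /= setT0D !T4.
    rewrite !in_setR; case: eqP => // ->; case: eqP => // ->.
    by rewrite e eqxx.
  rewrite mul0n; apply/eqP; rewrite cards_eq0; apply/eqP/setP => -[x y].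
  rewrite in_set0 inE /= setT0D !T4 !in_setR; apply/negP.
  case/and3P => /eqP-> /eqP-> /eqP/negb_inj e.
  by rewrite e eqxx in ne.
by rewrite in_setI !in_setR c0 ![3 == _]eq_sym.
Qed.

End Classes.

Theorem mainTheorem17 (F : finFieldType) (h q : nat) (h_gt0 : (0 < h)%N)
    (hq : q = (2 ^ h)%N) (cardF : #|F| = (q ^ 2)%N)
    (l m : {set {set 'cV[F]_3}})
    (hl : l \in nontangent_lines F) (hm : m \in nontangent_lines F)
    (hlm : l != m) (hrho : rho_hat l m = 0) :
  (l \in secant_lines F /\ m \in secant_lines F) /\
  \matrix_(i < 5, j < 5) ((p4 h l m i j)%:R : rat) = p4_matrix q%:R.
Proof.
have cF : #|F| = (2 ^ (2 * h))%N by rewrite cardF hq -expnM mulnC.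
have char2 : 2%N \in [pchar F] by apply: card_finPcharP cF _.
have [p lE] := nontangent_line_of char2 hl.
have [n mE] := nontangent_line_of char2 hm.
rewrite {l hl}lE {m hm}mE rho_hat_line_of (inj_eq (@line_of_inj F)) in hlm hrho *.
split; first exact: secant_of_rho0.
have qk : q = (2 * 2 ^ h.-1)%N by rewrite hq -expnS prednK.
have k_gt0 : (0 < 2 ^ h.-1)%N by rewrite expn_gt0.
(* The natural subtraction is exact, since q = 2k with k > 0 gives q^2 >= 2. *)
have cQ : (#|F| - 2)%:R = (2 * (2 ^ h.-1)%:R) ^+ 2 - 2 :> rat.
  rewrite cardF natrB qk; first by rewrite natrX natrM.
  by rewrite expnMn (@leq_mul 2 1) // expn_gt0 k_gt0.
apply/matrixP => i j; rewrite !mxE.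
have := congr1 (fun x => x%:R : rat) (p4_line_of h_gt0 cF i j hlm hrho).
rewrite !(natrD, natrM) cQ !card_setR //= qk natrM.
move: (p4 _ _ _ _ _)%:R (2 ^ h.-1)%:R => P k.
(* Each of the 25 equations is linear in the entry [P], with coefficients and constants polynomial
   in k = q/2. *)
case: i => [[|[|[|[|[|//]]]]] ?]; case: j => [[|[|[|[|[|//]]]]] ?] /=;
  rewrite -?val_eqE /= => E; lra.
Qed.
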